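(* A map $\varphi\in Map(2^{\{1,2,3,4,5\}},\mathbb N)$ belongs to the image of the map $\pi\colon(\mathbb P^3)^5\to Map(2^{\{1,2,3,4,5\}},\mathbb N)$ if and only if the rank type of $\varphi$ is one of the types in the following table. (Each entry gives the type, the configuration it depicts, and after ''$\times$'' the number of configurations of ordered five points; no number is written when there is only one.) - $(\emptyset)$: all five points coincide; - $(2)$a: two distinct points with multiplicities $4,1$; $\times 5$; - $(2)$b: two distinct points with multiplicities $3,2$; $\times 10$; - $(3)$a: three distinct collinear points with multiplicities $2,2,1$; $\times 15$; - $(3)$b: three distinct collinear points with multiplicities $3,1,1$; $\times 10$; - $(4)$: four distinct collinear points with multiplicities $2,1,1,1$; $\times 10$; - $(5)$: five distinct collinear points; - $(3,3)$a: three non-collinear points with multiplicities $2,2,1$; $\times 15$; - $(3,3)$b: three non-collinear points with multiplicities $3,1,1$; $\times 10$; - $(4,4)$a: three distinct simple points on a line and one double point off the line; $\times 10$; - $(4,4)$b: three distinct points on a line, one of them double, and one simple point off the line; $\times 30$; - $(5,5)$: four distinct points on a line and one point off the line; $\times 5$; - $(4,6)$: four distinct points spanning a plane, no three collinear, one of them double; $\times 10$; - $(5,6)$: five distinct points spanning a plane, with exactly two collinear triples, which share one point; $\times 15$; - $(5,8)$: five distinct points spanning a plane, with exactly one collinear triple; $\times 10$; - $(5,10)$: five distinct points spanning a plane, no three collinear; - $(4,6,4)$: four distinct points spanning $\mathbb P^3$, one of them double; $\times 10$; - $(5,8,5)$: five distinct points spanning $\mathbb P^3$, three of them collinear; $\times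 10$; - $(5,10,7)$: five distinct points spanning $\mathbb P^3$, four of them in a plane with no three of these four collinear; $\times 5$; - $(5,10,10)$: five points spanning $\mathbb P^3$, no four coplanar.
   Context: $\mathbb K$ is an algebraically closed field of characteristic $0$; $\mathbb P^3$ is the projective space of lines in $\mathbb K^4$; $\mathbb N=\{0,1,2,\dots\}$; $Map(2^{\{1,2,3,4,5\}},\mathbb N)$ is the set of all maps from the power set of $\{1,2,3,4,5\}$ to $\mathbb N$. The map $\pi$ sends $v=([v_i])_{i=1}^5\in(\mathbb P^3)^5$ to the map $\pi(v)\colon I\mapsto\dim\mathrm{Span}\{v_i\}_{i\in I}$, called the rank matrix of $v$. For $\varphi\in Map(2^{\{1,2,3,4,5\}},\mathbb N)$, an $r$-face of $\varphi$ is a maximal element of $\varphi^{-1}(r)\subset 2^{\{1,2,3,4,5\}}$ with respect to inclusion; $1$-, $2$- and $3$-faces are called vertices, edges and faces respectively. The rank type of $\varphi$ is the tuple $(A_1,A_2,A_3)$ of the numbers of vertices, edges and faces. In writing a type, a final $1,0,0,\dots$ is omitted: $(\emptyset)$ stands for $(1,0,0)$, $(A_1)$ for $(A_1,1,0)$, and $(A_1,A_2)$ for $(A_1,A_2,1)$. The letters a, b are not part of the rank type; they mark rank matrices that have the same rank type but are different as configurations. The multiplicity of a point is the number of indices $i$ for which $[v_i]$ equals that point; points whose multiplicity is not mentioned are simple.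
   Formalization: ''The rank type of φ is one of the types'' is strengthened to: φ has that rank type and is one of the maps read off the depicted configuration; otherwise the ''if'' fails, e.g. φ constantly 1 has type (∅) and φ(I)=|I| has type (5,10,10), but neither is a rank matrix. *)

(* Defs.v *)
From mathcomp Require Import all_boot all_algebra.

Set Implicit Arguments.
Unset Strict Implicit.
Unset Printing Implicit Defensive.

(* Map(2^{1,...,5}, N); the indices 1,...,5 are rendered as 0,...,4 : 'I_5. *)
Notation Map5 := {ffun {set 'I_5} -> nat}.

Section Geometry.
Variable K : fieldType.

Definition P3 := {L : {vspace 'rV[K]_4} | \dim L == 1}.

Implicit Types (v : {ffun 'I_5 -> P3}) (I : {set 'I_5}) (p : P3).

Definition Span v I : {vspace 'rV[K]_4} := (\sum_(i in I) val (v i))%VS.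

Definition rank_matrix v : Map5 := [ffun I => \dim (Span v I)].

Definition mult v p : nat := #|[set i | v i == p]|.

(* One entry for each distinct point of v, in no particular order. *)
Definition multiplicities v : seq nat := [seq mult v p | p <- undup (codom v)].

Definition with_mult v (m : seq nat) : bool := perm_eq (multiplicities v) m.

(* Spanning a line, a plane, P^3 in the projective sense: n = 2, 3, 4. *)
Definition spans v (n : nat) : bool := \dim (Span v setT) == n.

Definition collinear v I : bool := \dim (Span v I) <= 2.
Definition coplanar v I : bool := \dim (Span v I) <= 3.

Definition collinear_triples v : {set {set 'I_5}} :=
  [set T : {set 'I_5} | [&& #|T| == 3, dinjectiveb v T & collinear v T]].

(* A point of multiplicity m off a line which carries all the other points. *)
Definition one_off_line v (m : nat) : Prop :=
  exists p, let J := [set i | v i != p] in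
    [/\ mult v p = m, collinear v J & ~~ (val p <= Span v J)%VS].

End Geometry.

Definition is_face (r : nat) (phi : Map5) (I : {set 'I_5}) : bool :=
  maxset (fun J => phi J == r) I.

Definition rank_type (phi : Map5) : nat * nat * nat :=
  (#|[set I | is_face 1 phi I]|,
   #|[set I | is_face 2 phi I]|,
   #|[set I | is_face 3 phi I]|).

(* Ea1_a2_a3x is the entry of type (a1,a2,a3)x of the table, in the
   abbreviated form in which a final 1,0,0,... is dropped; E is (emptyset). *)
Inductive entry : Set :=
  | E | E2a | E2b | E3a | E3b | E4 | E5
  | E3_3a | E3_3b | E4_4a | E4_4b | E5_5
  | E4_6 | E5_6 | E5_8 | E5_10
  | E4_6_4 | E5_8_5 | E5_10_7 | E5_10_10.

Definition entry_type (t : entry) : nat * nat * nat :=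
  match t with
  | E => (1, 0, 0)
  | E2a | E2b => (2, 1, 0)
  | E3a | E3b => (3, 1, 0)
  | E4 => (4, 1, 0)
  | E5 => (5, 1, 0)
  | E3_3a | E3_3b => (3, 3, 1)
  | E4_4a | E4_4b => (4, 4, 1)
  | E5_5 => (5, 5, 1)
  | E4_6 => (4, 6, 1)
  | E5_6 => (5, 6, 1)
  | E5_8 => (5, 8, 1)
  | E5_10 => (5, 10, 1)
  | E4_6_4 => (4, 6, 4)
  | E5_8_5 => (5, 8, 5)
  | E5_10_7 => (5, 10, 7)
  | E5_10_10 => (5, 10, 10)
  end.

Definition entry_count (t : entry) : nat :=
  match t with
  | E => 1
  | E2a => 5
  | E2b => 10
  | E3a => 15
  | E3b => 10
  | E4 => 10
  | E5 => 1
  | E3_3a => 15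
  | E3_3b => 10
  | E4_4a => 10
  | E4_4b => 30
  | E5_5 => 5
  | E4_6 => 10
  | E5_6 => 15
  | E5_8 => 10
  | E5_10 => 1
  | E4_6_4 => 10
  | E5_8_5 => 10
  | E5_10_7 => 5
  | E5_10_10 => 1
  end.

Definition described_by (K : fieldType) (t : entry)
    (v : {ffun 'I_5 -> P3 K}) : Prop :=
  let ct := collinear_triples v in
  match t with
  | E => with_mult v [:: 5]
  | E2a => with_mult v [:: 4; 1]
  | E2b => with_mult v [:: 3; 2]
  | E3a => with_mult v [:: 2; 2; 1] /\ collinear v setT
  | E3b => with_mult v [:: 3; 1; 1] /\ collinear v setT
  | E4 => with_mult v [:: 2; 1; 1; 1] /\ collinear v setT
  | E5 => with_mult v [:: 1; 1; 1; 1; 1] /\ collinear v setT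
  | E3_3a => with_mult v [:: 2; 2; 1] /\ ~~ collinear v setT
  | E3_3b => with_mult v [:: 3; 1; 1] /\ ~~ collinear v setT
  | E4_4a => with_mult v [:: 2; 1; 1; 1] /\ one_off_line v 2
  | E4_4b => with_mult v [:: 2; 1; 1; 1] /\ one_off_line v 1
  | E5_5 => with_mult v [:: 1; 1; 1; 1; 1] /\ one_off_line v 1
  | E4_6 => [/\ with_mult v [:: 2; 1; 1; 1], spans v 3 & ct = set0]
  | E5_6 => [/\ with_mult v [:: 1; 1; 1; 1; 1], spans v 3 &
      exists T1 T2, ct = [set T1; T2] /\ #|T1 :&: T2| = 1]
  | E5_8 => [/\ with_mult v [:: 1; 1; 1; 1; 1], spans v 3 & #|ct| = 1]
  | E5_10 => [/\ with_mult v [:: 1; 1; 1; 1; 1], spans v 3 & ct = set0]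
  | E4_6_4 => with_mult v [:: 2; 1; 1; 1] /\ spans v 4
  | E5_8_5 => [/\ with_mult v [:: 1; 1; 1; 1; 1], spans v 4 &
      exists T, T \in ct]
  | E5_10_7 => [/\ with_mult v [:: 1; 1; 1; 1; 1], spans v 4 &
      exists F : {set 'I_5}, [/\ #|F| = 4, coplanar v F &
        forall T, T \in ct -> ~~ (T \subset F)]]
  | E5_10_10 => [/\ with_mult v [:: 1; 1; 1; 1; 1], spans v 4 &
      forall F : {set 'I_5}, #|F| = 4 -> ~~ coplanar v F]
  end.

(* The picture of a configuration: distinct points 0, 1, ... with their
   multiplicities, the lines through at least three of them, and the planes
   containing at least four of them not all on a line. *)
Record picture := Picture {
  point_mults : seq nat;
  lines : seq (seq nat);
  planes : seq (seq nat) }.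

Definition entry_picture (t : entry) : picture :=
  match t with
  | E => Picture [:: 5] [::] [::]
  | E2a => Picture [:: 4; 1] [::] [::]
  | E2b => Picture [:: 3; 2] [::] [::]
  | E3a => Picture [:: 2; 2; 1] [:: [:: 0; 1; 2]] [::]
  | E3b => Picture [:: 3; 1; 1] [:: [:: 0; 1; 2]] [::]
  | E4 => Picture [:: 2; 1; 1; 1] [:: [:: 0; 1; 2; 3]] [::]
  | E5 => Picture [:: 1; 1; 1; 1; 1] [:: [:: 0; 1; 2; 3; 4]] [::]
  | E3_3a => Picture [:: 2; 2; 1] [::] [::]
  | E3_3b => Picture [:: 3; 1; 1] [::] [::]
  | E4_4a => Picture [:: 1; 1; 1; 2] [:: [:: 0; 1; 2]] [:: [:: 0; 1; 2; 3]]
  | E4_4b => Picture [:: 2; 1; 1; 1] [:: [:: 0; 1; 2]] [:: [:: 0; 1; 2; 3]]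
  | E5_5 => Picture [:: 1; 1; 1; 1; 1]
      [:: [:: 0; 1; 2; 3]] [:: [:: 0; 1; 2; 3; 4]]
  | E4_6 => Picture [:: 2; 1; 1; 1] [::] [:: [:: 0; 1; 2; 3]]
  | E5_6 => Picture [:: 1; 1; 1; 1; 1]
      [:: [:: 0; 1; 2]; [:: 0; 3; 4]] [:: [:: 0; 1; 2; 3; 4]]
  | E5_8 => Picture [:: 1; 1; 1; 1; 1]
      [:: [:: 0; 1; 2]] [:: [:: 0; 1; 2; 3; 4]]
  | E5_10 => Picture [:: 1; 1; 1; 1; 1] [::] [:: [:: 0; 1; 2; 3; 4]]
  | E4_6_4 => Picture [:: 2; 1; 1; 1] [::] [::]
  | E5_8_5 => Picture [:: 1; 1; 1; 1; 1]
      [:: [:: 0; 1; 2]] [:: [:: 0; 1; 2; 3]; [:: 0; 1; 2; 4]]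
  | E5_10_7 => Picture [:: 1; 1; 1; 1; 1] [::] [:: [:: 0; 1; 2; 3]]
  | E5_10_10 => Picture [:: 1; 1; 1; 1; 1] [::] [::]
  end.

(* The rank, read off the picture, of a set J of drawn points. *)
Definition picture_rank (P : picture) (J : {set 'I_5}) : nat :=
  let inside := has (fun l : seq nat => [forall j in J, val j \in l]) in
  minn #|J| (if inside (lines P) then 2 else if inside (planes P) then 3 else 4).

(* phi is read off the picture P after its points have been labelled: the index
   i is placed at the point lab i. *)
Definition depicts (P : picture) (phi : Map5) : Prop :=
  exists lab : 'I_5 -> 'I_5,
    (forall j, #|[set i | lab i == j]| = nth 0 (point_mults P) j) /\
    (forall I, phi I = picture_rank P (lab @: I)).

(* The letters a, b are not part of the rank type, and maps which are not rank
   matrices can have the rank type of an entry, so being of the type of an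
   entry includes being one of the maps which the entry depicts. *)
Definition has_type (t : entry) (phi : Map5) : Prop :=
  rank_type phi = entry_type t /\ depicts (entry_picture t) phi.

Definition has_card (T : eqType) (A : T -> Prop) (n : nat) : Prop :=
  exists s : seq T, [/\ uniq s, size s = n & forall x, x \in s <-> A x].

(* Main.v *)
From HB Require Import structures.
Require Import Defs.
From mathcomp Require Import all_boot all_algebra.
Set Implicit Arguments.
Unset Strict Implicit.
Unset Printing Implicit Defensive.

Implicit Types (phi : Map5) (m : seq bool) (T : seq nat).

(** The rank matrix of five points is the rank function of a matroid on five
    elements, and the table is the list of all matroids of rank at most 4 on
    five labelled elements none of which is a loop; over a field of
    characteristic 0 each of them is represented by vectors.

    Three inputs carry the proof.  First, the rank matrix satisfies the matroid
    axioms ([rank_matrix_mono], [rank_matrix_small], [rank_matrix_submod], the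
    last one being Grassmann's dimension formula), and a finite search shows
    that only 184 maps satisfy them, all of which are read off the pictures of
    the table ([partial_tables_entries]).  Secondly, every picture is drawn
    with explicit integer points, whose ranks are found by an elimination that
    never divides; it is correct over every field of characteristic 0
    ([dim_span_gauss], [has_type_realized]).  Thirdly, each notion used to
    describe a configuration depends on the rank matrix alone: two points
    coincide when their pair has rank 1, a triple is collinear when its rank is
    at most 2, and a point is off the line of the other ones when adding it
    raises the rank ([described_byP]).

    The number of configurations of a type is the number of different maps
    obtained by labelling its picture in all ways that respect the
    multiplicities ([has_typeP], [has_card_type]).  Each map is stored as the list of its 32 values, the sets of indices being
    words of five bits ([get_table]).  The search, the labelled pictures and the
    descriptions become functions on such lists, and comparing them is a
    computation. *)

(** * Sets of indices as words of bits *)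

Definition indices : seq nat := iota 0 5.

Definition set_of_mask m : {set 'I_5} := [set i : 'I_5 | nth false m i].

Fixpoint words n : seq (seq bool) :=
  if n is n'.+1 then map (cons false) (words n') ++ map (cons true) (words n')
  else [:: [::]].

Definition masks := words 5.

(** The position of a word in [words n]; the first bit has the largest weight,
    and bits that are missing count as 0. *)
Fixpoint code n m : nat :=
  if n is n'.+1 then (if head false m then 2 ^ n' else 0) + code n' (behead m)
  else 0.

Definition weight m := count (nth false m) indices.

Definition unset_bit m i := set_nth false m i false.

Definition submask m m' :=
  all (fun i => nth false m i ==> nth false m' i) indices.

Lemma all_ordP (p : pred nat) :
  reflect (forall i : 'I_5, p i) (all p indices).
Proof.
rewrite /indices -val_enum_ord all_map; apply: (iffP allP) => [p_all i | p_all i _].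
  by apply: p_all; rewrite mem_enum.
exact: p_all.
Qed.

Lemma has_ordP (p : pred nat) :
  reflect (exists i : 'I_5, p i) (has p indices).
Proof.
rewrite /indices -val_enum_ord has_map; apply: (iffP hasP) => [[i _ pi] | [i pi]].
  by exists i.
by exists i; rewrite // mem_enum.
Qed.

Lemma card_ord_set (p : pred nat) :
  #|[set i : 'I_5 | p i]| = count p indices.
Proof.
by rewrite cardsE cardE /indices -val_enum_ord count_map -size_filter enumT.
Qed.

Lemma mkseqS (A : Type) (f : nat -> A) n :
  mkseq f n.+1 = f 0 :: mkseq (f \o S) n.
Proof. by rewrite /mkseq /= (iotaDl 1 0 n) -map_comp. Qed.

Lemma size_words n : size (words n) = 2 ^ n.
Proof. by elim: n => //= n IHn; rewrite size_cat !size_map IHn expnS mul2n -addnn. Qed.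

Lemma code_lt n m : code n m < 2 ^ n.
Proof.
elim: n m => //= n IHn m; rewrite expnS mul2n -addnn.
by case: ifP => _; [rewrite ltn_add2l IHn | rewrite ltn_addr ?IHn].
Qed.

Lemma nth_words n m : nth [::] (words n) (code n m) = mkseq (nth false m) n.
Proof.
elim: n m => //= n IHn m; rewrite mkseqS nth_cat size_map size_words.
rewrite (@eq_mkseq _ _ (nth false (behead m))); last first.
  by case: m => [|b m] i //=; rewrite nth_nil.
case m0: (head false m).
  rewrite ltnNge leq_addr /= addKn (nth_map [::]) ?size_words ?code_lt //.
  by rewrite IHn nth0 m0.
by rewrite code_lt (nth_map [::]) ?size_words ?code_lt // IHn nth0 m0.
Qed.

Lemma mem_words n m : (m \in words n) = (size m == n).
Proof.
elim: n m => [|n IHn] [|b m] //=; rewrite mem_cat.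
  by apply/orP => -[] /mapP[].
rewrite eqSS -IHn; apply/orP/idP => [[] /mapP[m' m'w [_ ->]] // | mw].
by case: b; [right | left]; apply: map_f.
Qed.

Lemma words_uniq n : uniq (words n).
Proof.
elim: n => //= n IHn; rewrite cat_uniq !map_inj_uniq ?IHn; try by move=> ? ? [].
by rewrite andbT; apply/hasPn => _ /mapP[m _ ->]; apply/negP => /mapP[m' _].
Qed.

Lemma code_nth_words n k : k < 2 ^ n -> code n (nth [::] (words n) k) = k.
Proof.
rewrite -size_words => k_lt; set m := nth _ _ k.
have /eqP size_m : size m == n by rewrite -mem_words mem_nth.
have m_code : nth [::] (words n) (code n m) = m.
  by rewrite nth_words -size_m mkseq_nth.
apply/eqP; rewrite -(nth_uniq [::] _ k_lt (words_uniq n)) ?m_code //.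
by rewrite size_words code_lt.
Qed.

Definition mask_of_set (I : {set 'I_5}) : seq bool := [seq i \in I | i <- enum 'I_5].

Lemma mask_of_set_masks I : mask_of_set I \in masks.
Proof. by rewrite mem_words size_map size_enum_ord. Qed.

Lemma mask_of_setK : cancel mask_of_set set_of_mask.
Proof.
move=> I; apply/setP => i; rewrite inE (nth_map i) ?size_enum_ord //.
by rewrite nth_ord_enum.
Qed.

Lemma set_of_maskK m : m \in masks -> mask_of_set (set_of_mask m) = m.
Proof.
rewrite mem_words => /eqP size_m.
apply: (@eq_from_nth _ false); rewrite size_map size_enum_ord // => i i_lt5.
by rewrite (nth_map (Ordinal i_lt5)) ?size_enum_ord // inE nth_enum_ord.
Qed.

Lemma all_setP (p : pred {set 'I_5}) :
  reflect (forall I, p I) (all (fun m => p (set_of_mask m)) masks).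
Proof.
apply: (iffP allP) => [p_all I | p_all m _ //].
by rewrite -[I]mask_of_setK; apply/p_all/mask_of_set_masks.
Qed.

Lemma has_setP (p : pred {set 'I_5}) :
  reflect (exists I, p I) (has (fun m => p (set_of_mask m)) masks).
Proof.
apply: (iffP hasP) => [[m _ pm] | [I pI]]; first by exists (set_of_mask m).
by exists (mask_of_set I); rewrite ?mask_of_set_masks // mask_of_setK.
Qed.

Lemma card_set_set (p : pred {set 'I_5}) :
  #|[set I | p I]| = count (fun m => p (set_of_mask m)) masks.
Proof.
rewrite -(@eq_count _ (preim set_of_mask p)) // -count_map -size_filter.
rewrite cardsE cardE; apply/perm_size/uniq_perm; first exact: enum_uniq.
  rewrite filter_uniq // map_inj_in_uniq ?words_uniq // => m m' mw m'w eq_mm'.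
  by rewrite -(set_of_maskK mw) eq_mm' set_of_maskK.
move=> I; rewrite mem_enum mem_filter.
suff ->: I \in map set_of_mask masks by rewrite andbT.
by rewrite -[I]mask_of_setK map_f ?mask_of_set_masks.
Qed.

Lemma card_set_of_mask m : #|set_of_mask m| = weight m.
Proof. exact: card_ord_set. Qed.

Lemma subset_mask m m' : (set_of_mask m \subset set_of_mask m') = submask m m'.
Proof.
apply/subsetP/all_ordP => [sub i | sub i]; first by have:= sub i; rewrite !inE => /implyP.
by have/implyP := sub i; rewrite !inE.
Qed.

Lemma unset_bit_set m (i : 'I_5) :
  set_of_mask (unset_bit m i) = set_of_mask m :\ i.
Proof.
apply/setP => j; rewrite !inE nth_set_nth /= -val_eqE /=.
by case: eqP.
Qed.

Lemma code_unset_bit n m i : code n (unset_bit m i) <= code n m.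
Proof.
elim: n m i => //= n IHn m i.
case: m i => [|b m] [|i] /=; rewrite ?leq_add2r ?leq_add2l //.
  by case: i => [|i]; [exact: (IHn [::] 0) | exact: (IHn [::] i.+1)].
exact: IHn.
Qed.

(** * Maps as tables of 32 values *)

Definition table phi : seq nat := [seq phi (set_of_mask m) | m <- masks].

Definition get T m : nat := nth 0 T (code 5 m).

(** Both sides only see the first five bits of the word, a missing bit counting
    as 0. *)
Lemma get_table phi m : get (table phi) m = phi (set_of_mask m).
Proof.
rewrite /get (nth_map [::]) ?size_words ?code_lt // nth_words.
congr (phi _); apply/setP => i; rewrite !inE nth_mkseq //.
Qed.

Lemma table_inj : injective table.
Proof.
move=> phi psi eq_table; apply/ffunP => I.
by rewrite -[I]mask_of_setK -!get_table eq_table.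
Qed.

Definition map_of_table T : Map5 := [ffun I => get T (mask_of_set I)].

Lemma map_of_tableK T : size T = 32 -> table (map_of_table T) = T.
Proof.
move=> size_T; apply: (@eq_from_nth _ 0); rewrite size_map size_words // => k k_lt.
rewrite (nth_map [::]) ?size_words // ffunE set_of_maskK ?mem_nth ?size_words //.
by rewrite /get code_nth_words.
Qed.

(** * Types and pictures read off tables *)

Definition is_face_mask r T m : bool :=
  if get T m == r then
    all (fun m' => (submask m m' && (get T m' == r)) ==> submask m' m) masks
  else false.

Lemma is_face_maskE r phi m :
  is_face r phi (set_of_mask m) = is_face_mask r (table phi) m.
Proof.
pose le_max (J : {set 'I_5}) :=
  (set_of_mask m \subset J) && (phi J == r) ==> (J \subset set_of_mask m).
rewrite /is_face_mask get_table (@eq_all _ _ (fun m' => le_max (set_of_mask m'))).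
  apply/maxsetP/andP => [[phi_r max_m] | [phi_r /(all_setP le_max) max_m]].
    split=> //; apply/(all_setP le_max) => J; apply/implyP => /andP[mJ Jr].
    by rewrite (max_m J).
  split=> // J Jr mJ; apply/eqP; rewrite eqEsubset mJ andbT.
  by have := max_m J; rewrite /le_max mJ Jr.
by move=> m' /=; rewrite /le_max !subset_mask get_table.
Qed.

Definition rank_type_mask T : nat * nat * nat :=
  (count (is_face_mask 1 T) masks, count (is_face_mask 2 T) masks,
   count (is_face_mask 3 T) masks).

Lemma rank_type_maskE phi : rank_type phi = rank_type_mask (table phi).
Proof.
by rewrite /rank_type !card_set_set; do 2?congr pair; apply: eq_count => m;
   apply: is_face_maskE.
Qed.

Definition picture_rank_mask (P : picture) m : nat :=
  let inside := has (fun l : seq nat =>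
     all (fun j => nth false m j ==> (j \in l)) indices) in
  minn (weight m) (if inside (lines P) then 2 else
                   if inside (planes P) then 3 else 4).

Lemma picture_rank_maskE P m :
  picture_rank P (set_of_mask m) = picture_rank_mask P m.
Proof.
rewrite /picture_rank card_set_of_mask.
have insideE (ll : seq (seq nat)) :
    has (fun l => [forall j in set_of_mask m, val j \in l]) ll =
    has (fun l => all (fun j => nth false m j ==> (j \in l)) indices) ll.
  apply: eq_has => l; apply/forallP/all_ordP => l_j j; first by have := l_j j; rewrite inE.
  by rewrite inE; apply: l_j.
by rewrite !insideE.
Qed.

(** A labelling of the indices by drawn points is stored as the list of its
    values, here [l]. *)
Definition image_mask (l : seq nat) m :=
  [seq has (fun i => nth false m i && (nth 0 l i == j)) indices | j <- indices].

Lemma imset_mask (lab : 'I_5 -> 'I_5) m :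
  lab @: set_of_mask m =
  set_of_mask (image_mask [seq val (lab i) | i <- enum 'I_5] m).
Proof.
have nth_lab (i : 'I_5) : nth 0 [seq val (lab i) | i <- enum 'I_5] i = lab i.
  by rewrite (nth_map i) ?size_enum_ord // nth_ord_enum.
apply/setP => j; rewrite inE (nth_map 0) ?size_iota // nth_iota // add0n.
apply/imsetP/has_ordP => [[i im ->] | [i /andP[im /eqP ij]]].
  by exists i; rewrite nth_lab eqxx andbT; move: im; rewrite inE.
by exists i; [rewrite inE | apply: val_inj; rewrite /= -ij nth_lab].
Qed.

Definition label_word (ms : seq nat) : seq nat :=
  flatten [seq nseq (nth 0 ms j) j | j <- indices].

Lemma mem_label_word ms x : x \in label_word ms -> x < 5.
Proof.
by case/flattenP => _ /mapP[j j_lt ->]; rewrite mem_nseq => /andP[_ /eqP->];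
  rewrite mem_iota in j_lt.
Qed.

Lemma count_label_word ms (j : 'I_5) : count_mem (val j) (label_word ms) = nth 0 ms j.
Proof.
rewrite /label_word /= !count_cat !count_nseq /=.
by case: j => -[|[|[|[|[|]]]]] //= _; rewrite ?mul1n ?mul0n ?addn0.
Qed.

Definition labellings (ms : seq nat) : seq (seq nat) :=
  permutations (label_word ms).

(** Prescribing how often each value is taken is prescribing a word up to the
    order of its letters. *)
Lemma labellingsP ms (lab : 'I_5 -> 'I_5) :
  [seq val (lab i) | i <- enum 'I_5] \in labellings ms <->
  forall j : 'I_5, #|[set i | lab i == j]| = nth 0 ms j.
Proof.
rewrite mem_permutations.
have cardE_lab (j : 'I_5) : #|[set i | lab i == j]| =
    count_mem (val j) [seq val (lab i) | i <- enum 'I_5].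
  by rewrite cardsE cardE size_filter count_map enumT; apply: eq_count.
split=> [/permP eq_count_w j | card_lab]; first by rewrite cardE_lab eq_count_w count_label_word.
apply/allP => x; rewrite mem_cat => x_in /=.
have x_lt5 : x < 5.
  by case/orP: x_in => [/mapP[i _ ->] | /mem_label_word //]; apply: ltn_ord.
by rewrite -[x]/(val (Ordinal x_lt5)) -cardE_lab card_lab count_label_word.
Qed.

Definition labelled_table P l :=
  [seq picture_rank_mask P (image_mask l m) | m <- masks].

Lemma depictsP P phi : size (label_word (point_mults P)) = 5 ->
  depicts P phi <->
  table phi \in [seq labelled_table P l | l <- labellings (point_mults P)].
Proof.
move=> size_w.
have table_lab (lab : 'I_5 -> 'I_5) :
   (forall I, phi I = picture_rank P (lab @: I)) <->
   table phi = labelled_table P [seq val (lab i) | i <- enum 'I_5].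
  split=> [phiE | tableE I].
    by apply: eq_map => m; rewrite phiE imset_mask picture_rank_maskE.
  rewrite -[I]mask_of_setK imset_mask picture_rank_maskE.
  have /eq_in_map := tableE; apply; exact: mask_of_set_masks.
split=> [[lab [card_lab /table_lab ->]] | ].
  by apply: map_f; apply/labellingsP.
case/mapP => l l_lab tableE.
have l_perm : perm_eq l (label_word (point_mults P)) by rewrite -mem_permutations.
have size_l : size l = 5 by rewrite (perm_size l_perm).
pose lab (i : 'I_5) : 'I_5 := inord (nth 0 l i).
have lE : [seq val (lab i) | i <- enum 'I_5] = l.
  apply: (@eq_from_nth _ 0); rewrite size_map size_enum_ord // => i i_lt5.
  rewrite (nth_map ord0) ?size_enum_ord // /lab /= nth_enum_ord // inordK //.
  by apply: (@mem_label_word (point_mults P)); rewrite -(perm_mem l_perm) mem_nth // size_l.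
exists lab; split; first by apply/labellingsP; rewrite lE.
by apply/table_lab; rewrite lE.
Qed.

(** * The maps of each type *)

Definition entries : seq entry :=
  [:: E; E2a; E2b; E3a; E3b; E4; E5; E3_3a; E3_3b; E4_4a; E4_4b; E5_5;
      E4_6; E5_6; E5_8; E5_10; E4_6_4; E5_8_5; E5_10_7; E5_10_10].

Lemma entry_comparable : comparable entry.
Proof. by rewrite /comparable /decidable; decide equality. Defined.

HB.instance Definition _ := comparableMixin entry_comparable.

Lemma mem_entries t : t \in entries.
Proof. by case: t. Qed.

Definition entry_tables t : seq (seq nat) :=
  undup [seq labelled_table (entry_picture t) l
        | l <- labellings (point_mults (entry_picture t))].

(** Every map depicted by an entry has the rank type of that entry, so that the
    first half of [has_type] follows from the second. *)
Lemma entry_tables_type :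
  all (fun t => all (fun T => rank_type_mask T == entry_type t) (entry_tables t)) entries.
Proof. by vm_compute. Qed.

Lemma has_typeP t phi : has_type t phi <-> table phi \in entry_tables t.
Proof.
have depictsE : depicts (entry_picture t) phi <-> table phi \in entry_tables t.
  by rewrite mem_undup; apply: depictsP; case: t.
split=> [[_ /depictsE] // | T_t]; split; last exact/depictsE.
rewrite rank_type_maskE; apply/eqP.
exact: (allP (allP entry_tables_type t (mem_entries t))).
Qed.

Lemma has_card_type t : has_card (has_type t) (entry_count t).
Proof.
exists [seq map_of_table T | T <- entry_tables t].
have size_T T : T \in entry_tables t -> size T = 32.
  by rewrite mem_undup => /mapP[l _ ->]; rewrite size_map size_words.
have tableK : {in entry_tables t, cancel map_of_table table}.
  by move=> T /size_T; apply: map_of_tableK.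
split; first by rewrite (map_inj_in_uniq (can_in_inj tableK)) undup_uniq.
  by rewrite size_map; case: (t); vm_compute.
move=> phi; split=> [/mapP[T T_t ->] | /has_typeP T_t].
  by apply/has_typeP; rewrite tableK.
apply/mapP; exists (table phi) => //; apply: table_inj.
by rewrite map_of_tableK // size_T.
Qed.

(** * The search for rank functions *)

(** The matroid axioms in local form, at the set [m]: rank at most 4, rank equal
    to the cardinality up to one element, steps of 0 or 1 and submodularity for
    the two sets obtained by removing one element.  They only involve [m] and
    its subsets, and submodularity, symmetric in the two removed elements, is
    only tested for [j < i].  Conjunctions are written with [if] so that a test
    that fails stops the evaluation. *)
Definition rank_ok (rk : seq bool -> nat) m : bool :=
  let r := rk m in
  if r <= 4 then
  if (weight m <= 1) ==> (r == weight m) then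
  all (fun i => let mi := unset_bit m i in let ri := rk mi in
    if ri <= r <= ri.+1 then
    all (fun j => r + rk (unset_bit mi j) <= ri + rk (unset_bit m j))
    (iota 0 i) else false) indices
  else false else false.

(** The axioms at the words that come first in [masks] form a condition on an
    initial segment of the table, since removing elements makes the code
    smaller; this is why the search may fill tables from left to right. *)
Lemma eq_rank_ok rk rk' m :
  (forall m', code 5 m' <= code 5 m -> rk m' = rk' m') ->
  rank_ok rk m = rank_ok rk' m.
Proof.
move=> eq_rk; rewrite /rank_ok eq_rk //.
have le1 i : code 5 (unset_bit m i) <= code 5 m by apply: code_unset_bit.
have le2 i j : code 5 (unset_bit (unset_bit m i) j) <= code 5 m.
  exact: leq_trans (code_unset_bit _ _ _) (le1 i).
do 2!case: ifP => // _; apply: eq_all => i; rewrite eq_rk //.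
by case: ifP => // _; apply: eq_all => j; rewrite !eq_rk.
Qed.

Fixpoint partial_tables n : seq (seq nat) :=
  if n is n'.+1 then
    let m := nth [::] masks n' in
    flatten [seq [seq T' <- [seq rcons T r | r <- indices] | rank_ok (get T') m]
            | T <- partial_tables n']
  else [:: [::]].

(** The search loses no solution: the beginnings of a table of ranks survive every
    step. *)
Lemma mem_partial_tables T :
    size T = 32 -> all (fun m => rank_ok (get T) m) masks ->
  T \in partial_tables 32.
Proof.
move=> size_T /allP T_ok.
suff take_T n : n <= 32 -> take n T \in partial_tables n.
  by have := take_T 32 isT; rewrite -size_T take_size.
elim: n => [|n IHn] n_lt; first by rewrite take0.
have m_in : nth [::] masks n \in masks by rewrite mem_nth ?size_words.
have m_ok := T_ok _ m_in.
apply/flattenP; exists [seq T' <- [seq rcons (take n T) r | r <- indices]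
                       | rank_ok (get T') (nth [::] masks n)].
  by apply/mapP; exists (take n T); rewrite // IHn // ltnW.
have code_n : code 5 (nth [::] masks n) = n by rewrite code_nth_words.
rewrite mem_filter (@eq_rank_ok _ (get T)) => [|m' m'_le]; last first.
  by rewrite /get nth_take // ltnS -code_n.
rewrite m_ok (take_nth 0) ?size_T // map_f // mem_iota /= add0n.
move: m_ok; rewrite /rank_ok; case: ifP => // + _.
by rewrite /get code_n ltnS.
Qed.

(** The heart of the classification: the search leaves 184 tables, few enough to
    be looked up one by one. *)
Lemma partial_tables_entries :
  let tables := flatten [seq entry_tables t | t <- entries] in
  all (fun T => T \in tables) (partial_tables 32).
Proof. by vm_compute. Qed.

Lemma partial_tableP T :
  T \in partial_tables 32 -> exists t, T \in entry_tables t.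
Proof.
by move/(allP partial_tables_entries)/flattenP => [_ /mapP[t _ ->] T_t]; exists t.
Qed.

(** * The axioms hold for points *)

Section RankMatrix.
Variable K : fieldType.
Implicit Types (v : {ffun 'I_5 -> P3 K}) (I J : {set 'I_5}).

Lemma Span_sub v I J : I \subset J -> (Span v I <= Span v J)%VS.
Proof.
move=> /subsetP IJ; apply/subv_sumP => i iI.
by apply: (sumv_sup i); rewrite ?IJ.
Qed.

Lemma Span_setU1 v i I : Span v (i |: I) = (val (v i) + Span v I)%VS.
Proof.
apply/eqP; rewrite eqEsubv subv_add (Span_sub v (subsetUr _ _)) andbT.
apply/andP; split; last by apply: (sumv_sup i); rewrite ?setU11.
apply/subv_sumP => j; rewrite !inE => /orP[/eqP->|jI]; first exact: addvSl.
by apply: subv_trans (addvSr _ _); apply: (sumv_sup j).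
Qed.

Lemma dim_point (p : P3 K) : \dim (val p) = 1.
Proof. exact/eqP/(valP p). Qed.

Lemma rank_matrix_mono v I J :
  I \subset J -> rank_matrix v I <= rank_matrix v J.
Proof. by move=> IJ; rewrite !ffunE dimvS // Span_sub. Qed.

Lemma rank_matrix_small v I : #|I| <= 1 -> rank_matrix v I = #|I|.
Proof.
rewrite leq_eqVlt ltnS leqn0 ffunE /Span => /orP[/cards1P[i ->] | ].
  by rewrite big_set1 dim_point cards1.
by rewrite cards_eq0 => /eqP->; rewrite big_set0 dimv0 cards0.
Qed.

(** The span of an intersection lies in the intersection of the spans, and may be
    smaller; hence an inequality. *)
Lemma rank_matrix_submod v I J :
  rank_matrix v (I :|: J) + rank_matrix v (I :&: J) <= rank_matrix v I + rank_matrix v J.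
Proof.
rewrite !ffunE -(dimv_sum_cap (Span v I)); apply: leq_add; apply: dimvS.
  apply/subv_sumP => i; rewrite inE => /orP[] iIJ.
    by apply: subv_trans (addvSl _ _); apply: (sumv_sup i).
  by apply: subv_trans (addvSr _ _); apply: (sumv_sup i).
by rewrite subv_cap !Span_sub ?subsetIl ?subsetIr.
Qed.

Lemma rank_matrix_ok v m :
  rank_ok (fun m' => rank_matrix v (set_of_mask m')) m.
Proof.
set phi := rank_matrix v; rewrite /rank_ok.
have -> : phi (set_of_mask m) <= 4.
  rewrite ffunE; apply: leq_trans (dimvS (subvf _)) _.
  by rewrite dimvf /dim /= mul1n.
have -> : (weight m <= 1) ==> (phi (set_of_mask m) == weight m).
  apply/implyP; rewrite -card_set_of_mask => small_m.
  exact/eqP/rank_matrix_small.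
apply/(@all_ordP (fun i => _)) => i; rewrite unset_bit_set.
set I := set_of_mask m.
have -> : phi (I :\ i) <= phi I <= (phi (I :\ i)).+1.
  rewrite rank_matrix_mono ?subsetDl //= -(addn1 (phi _)).
  have sI : I \subset (I :\ i) :|: [set i].
    by apply/subsetP => k; rewrite !inE => ->; rewrite andbT orNb.
  apply: leq_trans (rank_matrix_mono v sI) _.
  apply: leq_trans (leq_addr _ _) (leq_trans (rank_matrix_submod v _ _) _).
  by rewrite leq_add2l (@rank_matrix_small _ [set i]) cards1.
apply/allP => j; rewrite mem_iota add0n /= => j_lt_i.
have j_lt5 := ltn_trans j_lt_i (ltn_ord i).
have -> : j = Ordinal j_lt5 by [].
rewrite !unset_bit_set -/I.
apply: leq_trans (rank_matrix_submod v (I :\ i) (I :\ Ordinal j_lt5)).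
apply: leq_add; apply: rank_matrix_mono; apply/subsetP => k; rewrite !inE.
  move=> ->; rewrite !andbT -negb_and; apply/negP => /andP[/eqP-> /eqP ij].
  by rewrite ij ltnn in j_lt_i.
by case/and3P=> -> -> ->.
Qed.

Lemma rank_matrix_table v : table (rank_matrix v) \in partial_tables 32.
Proof.
apply: mem_partial_tables; first by rewrite size_map size_words.
apply/allP => m _; rewrite (@eq_rank_ok _ _ _ (fun m' _ => get_table _ m')).
exact: rank_matrix_ok.
Qed.

Lemma rank_matrix_has_type v : exists t, has_type t (rank_matrix v).
Proof.
by have [t /has_typeP] := partial_tableP (rank_matrix_table v); exists t.
Qed.

End RankMatrix.

(** * Ranks of integer vectors in characteristic 0 *)

Section Gauss.
Variable K : fieldType.
Hypothesis charK : [pchar K]%R =i pred0.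
Local Open Scope ring_scope.
Import GRing.Theory.
Implicit Types (w u : seq int) (ws : seq (seq int)).

Lemma intr_neq0 (z : int) : z != 0 -> z%:~R != 0 :> K.
Proof.
have natr_neq0 n : (n != 0)%N -> n%:R != 0 :> K by rewrite (GRing.pcharf0P K).1.
case: z => n z_neq0; first exact: natr_neq0.
by rewrite NegzE mulrNz oppr_eq0 natr_neq0.
Qed.

Definition vector n w : 'rV[K]_n := \row_j (w`_j)%:~R.

(** The first coordinate of [w`_0 *: u - u`_0 *: w] vanishes and is dropped. *)
Definition eliminate n w u : seq int :=
  mkseq (fun k => w`_0 * u`_k.+1 - u`_0 * w`_k.+1) n.

(** The pivot stays in the list: it is eliminated into a zero vector, which does
    not change the rank of the remaining vectors. *)
Fixpoint gauss_rank n ws : nat :=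
  if n is n'.+1 then
    if [seq w <- ws | w`_0 != 0] is w :: _
    then (gauss_rank n' [seq eliminate n' w u | u <- ws]).+1
    else gauss_rank n' [seq behead w | w <- ws]
  else 0.

(** The hyperplane of vectors with first coordinate 0, into which elimination
    moves the remaining vectors. *)
Definition pad n : 'Hom('rV[K]_n, 'rV[K]_n.+1) :=
  linfun (mulmxr (row_mx 0 1%:M : 'M_(n, 1 + n))).

Lemma padE n (x : 'rV[K]_n) : pad n x = row_mx (0 : 'rV_1) x.
Proof.
rewrite lfunE /=; apply: etrans (mul_mx_row x (0 : 'M_(n, 1)) (1%:M : 'M_n)) _.
by rewrite mulmx0 mulmx1.
Qed.

Lemma dim_pad n (U : {vspace 'rV[K]_n}) : \dim (pad n @: U) = \dim U.
Proof.
apply: limg_dim_eq; suff /eqP->: lker (pad n) == 0%VS by rewrite capv0.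
apply/lker0P => x y; rewrite !padE => eq_xy.
by case: (@eq_row_mx _ 1 1 n _ _ _ _ eq_xy).
Qed.

(** With a pivot [w], the vectors span the same space as [w] and the vectors
    obtained by elimination, because [w`_0] is invertible; the sum is direct
    because the latter have first coordinate 0.  Without a pivot all first
    coordinates are 0. *)
Lemma dim_span_gauss n ws : \dim <<[seq vector n w | w <- ws]>> = gauss_rank n ws.
Proof.
elim: n ws => [|n IHn] ws /=.
  apply/eqP; rewrite -leqn0; apply: leq_trans (dimvS (subvf _)) _.
  by rewrite dimvf /dim /= muln0.
case piv: [seq w <- ws | w`_0 != 0] => [|w ?].
  have -> : [seq vector n.+1 w | w <- ws] =
      [seq pad n (vector n (behead w)) | w <- ws]; last first.
    by rewrite -IHn -[RHS]dim_pad limg_span -!map_comp.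
  apply/eq_in_map => w w_ws /=.
  have w0 : w`_0 = 0.
    apply: contraTeq isT => w0; have : w \in [seq w <- ws | w`_0 != 0].
      by rewrite mem_filter w0.
    by rewrite piv.
  apply/rowP => j; rewrite padE !mxE; case: splitP => k /= ->.
    by rewrite ord1 w0 mxE.
  by rewrite mxE nth_behead.
have [w0 w_ws] : w`_0 != 0 /\ w \in ws.
  by apply/andP; rewrite -(mem_filter (fun w => w`_0 != 0)) piv mem_head.
have w0K : (w`_0)%:~R != 0 :> K by apply: intr_neq0.
have elimE u : pad n (vector n (eliminate n w u)) =
    (w`_0)%:~R *: vector n.+1 u - (u`_0)%:~R *: vector n.+1 w.
  apply/rowP => j; rewrite padE !mxE; case: splitP => k /= ->.
    by rewrite ord1 mxE -!intrM -intrB mulrC subrr.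
  by rewrite mxE nth_mkseq // intrB !intrM.
set S := <<[seq vector n (eliminate n w u) | u <- ws]>>%VS.
have spanE : <<[seq vector n.+1 u | u <- ws]>>%VS = (<[vector n.+1 w]> + pad n @: S)%VS.
  rewrite limg_span -map_comp; apply/eqP; rewrite eqEsubv subv_add -memvE.
  rewrite memv_span ?map_f ?andbT //=; apply/andP; split.
    apply/span_subvP => _ /mapP[u u_ws ->].
    have -> : vector n.+1 u = (w`_0)%:~R^-1 *: ((u`_0)%:~R *: vector n.+1 w
        + pad n (vector n (eliminate n w u))).
      by rewrite elimE addrC subrK scalerA mulVf // scale1r.
    rewrite memvZ // memv_add ?memvZ ?memv_line // memv_span //.
    by apply/mapP; exists u.
  apply/span_subvP => _ /mapP[u u_ws ->] /=.
  by rewrite elimE rpredB // memvZ // memv_span ?map_f.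
rewrite spanE dimv_disjoint_sum ?dim_vline.
  have -> : vector n.+1 w != 0 by apply/rV0Pn; exists 0; rewrite mxE.
  by rewrite dim_pad /S -IHn -map_comp.
apply/eqP; rewrite -subv0; apply/subvP => x; rewrite memv_cap memv0.
case/andP=> /vlineP[a ->] /memv_imgP[y _ eq_xy].
have /eqP : (a *: vector n.+1 w) 0 0 = 0.
  by rewrite eq_xy padE mxE; case: splitP => // k _; rewrite mxE.
by rewrite !mxE mulf_eq0 (negPf w0K) orbF => /eqP->; rewrite scale0r.
Qed.

End Gauss.

(** * Every picture can be drawn *)

(** Each line of at least three points is a coordinate line, and each plane of
    at least four points is a coordinate plane; the coefficients 1, 2, 3 avoid
    all other coincidences. *)
Definition entry_points (t : entry) : seq (seq int) :=
  let e0 : seq int := [:: 1; 0; 0; 0]%R in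
  let e1 : seq int := [:: 0; 1; 0; 0]%R in
  let e2 : seq int := [:: 0; 0; 1; 0]%R in
  let e3 : seq int := [:: 0; 0; 0; 1]%R in
  match t with
  | E => [:: e0]
  | E2a | E2b => [:: e0; e1]
  | E3a | E3b => [:: e0; e1; [:: 1; 1; 0; 0]%R]
  | E4 => [:: e0; e1; [:: 1; 1; 0; 0]%R; [:: 1; 2; 0; 0]%R]
  | E5 => [:: e0; e1; [:: 1; 1; 0; 0]%R; [:: 1; 2; 0; 0]%R; [:: 1; 3; 0; 0]%R]
  | E3_3a | E3_3b => [:: e0; e1; e2]
  | E4_4a | E4_4b => [:: e0; e1; [:: 1; 1; 0; 0]%R; e2]
  | E5_5 => [:: e0; e1; [:: 1; 1; 0; 0]%R; [:: 1; 2; 0; 0]%R; e2]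
  | E4_6 => [:: e0; e1; e2; [:: 1; 1; 1; 0]%R]
  | E5_6 => [:: e0; e1; [:: 1; 1; 0; 0]%R; e2; [:: 1; 0; 1; 0]%R]
  | E5_8 => [:: e0; e1; [:: 1; 1; 0; 0]%R; e2; [:: 1; 2; 1; 0]%R]
  | E5_10 => [:: e0; e1; e2; [:: 1; 1; 1; 0]%R; [:: 1; 2; 3; 0]%R]
  | E4_6_4 => [:: e0; e1; e2; e3]
  | E5_8_5 => [:: e0; e1; [:: 1; 1; 0; 0]%R; e2; e3]
  | E5_10_7 => [:: e0; e1; e2; [:: 1; 1; 1; 0]%R; e3]
  | E5_10_10 => [:: e0; e1; e2; e3; [:: 1; 1; 1; 1]%R]
  end.

(** The labels beyond the drawn points have multiplicity 0, the default value of
    [nth], and no vector stands for them. *)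
Definition drawn_mask (P : picture) m : bool :=
  all (fun j => nth false m j ==> (nth 0 (point_mults P) j != 0)) indices.

Lemma entry_points_rank :
  all (fun t => all (fun m => drawn_mask (entry_picture t) m ==>
    (gauss_rank 4 [seq nth [::] (entry_points t) j | j <- indices & nth false m j]
      == picture_rank_mask (entry_picture t) m)) masks) entries.
Proof. by vm_compute. Qed.

Section Realization.
Variable K : fieldType.
Hypothesis charK : [pchar K]%R =i pred0.

Lemma dim_sum_lines (p : nat -> seq int) m :
  \dim (\sum_(j in set_of_mask m) <[vector K 4 (p j)]>) =
  gauss_rank 4 [seq p j | j <- indices & nth false m j].
Proof.
rewrite -(dim_span_gauss charK) -map_comp span_def big_map big_filter.
rewrite -[indices]/(index_iota 0 5) big_mkord; congr (\dim _).
by apply: eq_bigl => j; rewrite inE.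
Qed.

Lemma sum_labels (V : 'I_5 -> {vspace 'rV[K]_4}) (lab : 'I_5 -> 'I_5)
    (I : {set 'I_5}) :
  (\sum_(i in I) V (lab i) = \sum_(j in (lab @: I)%SET) V j)%VS.
Proof.
apply/eqP; rewrite eqEsubv; apply/andP; split; apply/subv_sumP.
  by move=> i iI; apply: (sumv_sup (lab i)); rewrite ?imset_f.
by move=> _ /imsetP[i iI ->]; apply: (sumv_sup i).
Qed.

(** The index [i] is placed at the point with the label of [i]; the span of the
    points of [I] then only depends on the set of labels of [I]. *)
Lemma has_type_realized t phi :
  has_type t phi -> exists v : {ffun 'I_5 -> P3 K}, rank_matrix v = phi.
Proof.
case=> _ [lab [card_lab phiE]].
set P := entry_picture t in card_lab phiE.
pose line (j : 'I_5) := <[vector K 4 (nth [::] (entry_points t) j)]>%VS.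
have dim_lines (I : {set 'I_5}) :
    \dim (\sum_(j in (lab @: I)%SET) line j) = picture_rank P (lab @: I).
  rewrite -[lab @: I]mask_of_setK; set m := mask_of_set _.
  rewrite picture_rank_maskE (dim_sum_lines (nth [::] (entry_points t))).
  have m_in : m \in masks by apply: mask_of_set_masks.
  have /allP/(_ m m_in)/implyP m_rank := allP entry_points_rank t (mem_entries t).
  apply/eqP/m_rank/all_ordP => j; apply/implyP => jm.
  rewrite -card_lab cards_eq0; apply/set0Pn.
  have /imsetP[i _ ji] : j \in lab @: I by rewrite -[_ @: _]mask_of_setK inE.
  by exists i; rewrite inE ji.
have dim_line i : \dim (line (lab i)) == 1.
  have := dim_lines [set i]; rewrite imset_set1 big_set1 => ->.
  by rewrite /picture_rank cards1; case: has; last case: has.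
exists [ffun i => exist _ (line (lab i)) (dim_line i)]; apply/ffunP => I.
rewrite phiE -dim_lines -sum_labels ffunE; congr (\dim _).
by apply: eq_bigr => i _; rewrite ffunE.
Qed.

End Realization.

(** * Descriptions read off tables *)

Definition full_mask := nseq 5 true.

Definition pair_mask (i j : nat) := [seq (k == i) || (k == j) | k <- indices].

Definition same_point T i j : bool := get T (pair_mask i j) == 1.

(** Follows the recursion of [undup], which keeps the last occurrence of each
    point. *)
Fixpoint table_mults T (s : seq nat) : seq nat :=
  if s is i :: s' then
    if has (same_point T i) s' then table_mults T s'
    else count (same_point T i) indices :: table_mults T s'
  else [::].

Definition with_mult_table T (ms : seq nat) := perm_eq (table_mults T indices) ms.

Definition collinear_triple_table T m : bool :=
  if weight m == 3 then
  if get T m <= 2 then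
  all (fun i => all (fun j =>
    [&& nth false m i, nth false m j & same_point T i j] ==> (i == j)) indices)
    indices
  else false else false.

(** All the points outside [J] coincide with the point [i], so this point is off
    the line that carries [J] exactly when the total rank exceeds that of [J]. *)
Definition one_off_line_table T n : bool :=
  has (fun i =>
    let J := [seq ~~ same_point T i j | j <- indices] in
    [&& count (same_point T i) indices == n, get T J <= 2
      & get T J < get T full_mask]) indices.

Definition described_table t T : bool :=
  let simple := [:: 1; 1; 1; 1; 1] in
  let collinear := get T full_mask <= 2 in
  let spans n := get T full_mask == n in
  let triple := collinear_triple_table T in
  match t with
  | E => with_mult_table T [:: 5]
  | E2a => with_mult_table T [:: 4; 1]
  | E2b => with_mult_table T [:: 3; 2]
  | E3a => with_mult_table T [:: 2; 2; 1] && collinear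
  | E3b => with_mult_table T [:: 3; 1; 1] && collinear
  | E4 => with_mult_table T [:: 2; 1; 1; 1] && collinear
  | E5 => with_mult_table T simple && collinear
  | E3_3a => with_mult_table T [:: 2; 2; 1] && ~~ collinear
  | E3_3b => with_mult_table T [:: 3; 1; 1] && ~~ collinear
  | E4_4a => with_mult_table T [:: 2; 1; 1; 1] && one_off_line_table T 2
  | E4_4b => with_mult_table T [:: 2; 1; 1; 1] && one_off_line_table T 1
  | E5_5 => with_mult_table T simple && one_off_line_table T 1
  | E4_6 => if with_mult_table T [:: 2; 1; 1; 1] && spans 3
            then ~~ has triple masks else false
  | E5_6 => if with_mult_table T simple && spans 3 then
              let lines := [seq m <- masks | triple m] in
              (size lines == 2) && all (fun m => all (fun m' =>
                (m == m') || (count (fun i => nth false m i && nth false m' i)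
                                    indices == 1)) lines) lines
            else false
  | E5_8 => if with_mult_table T simple && spans 3
            then count triple masks == 1 else false
  | E5_10 => if with_mult_table T simple && spans 3
             then ~~ has triple masks else false
  | E4_6_4 => with_mult_table T [:: 2; 1; 1; 1] && spans 4
  | E5_8_5 => if with_mult_table T simple && spans 4
              then has triple masks else false
  | E5_10_7 => if with_mult_table T simple && spans 4 then
                 has (fun m => if (weight m == 4) && (get T m <= 3)
                   then all (fun m' => triple m' ==> ~~ submask m' m) masks
                   else false) masks
               else false
  | E5_10_10 => if with_mult_table T simple && spans 4
                then all (fun m => (weight m == 4) ==> ~~ (get T m <= 3)) masks
                else false
  end.

Section Description.
Variables (K : fieldType) (v : {ffun 'I_5 -> P3 K}).
Let T := table (rank_matrix v).

Lemma get_rank_matrix m : get T m = \dim (Span v (set_of_mask m)).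
Proof. by rewrite get_table ffunE. Qed.

Lemma set_full_mask : set_of_mask full_mask = setT.
Proof. by apply/setP => -[[|[|[|[|[|]]]]] //= i]; rewrite !inE. Qed.

Lemma get_full_mask : get T full_mask = \dim (Span v setT).
Proof. by rewrite get_rank_matrix set_full_mask. Qed.

(** A sum of two lines has dimension 1 only if both of them are equal to it. *)
Lemma same_pointE (i j : 'I_5) : same_point T i j = (v i == v j).
Proof.
rewrite /same_point get_rank_matrix.
have -> : set_of_mask (pair_mask i j) = i |: [set j].
  by apply/setP => k; rewrite !inE (nth_map 0) ?size_iota // nth_iota.
rewrite Span_setU1 /Span big_set1; apply/idP/eqP => [dim1 | ->]; last first.
  by rewrite addvv dim_point.
apply/val_inj/eqP; set U := val (v i); set V := val (v j).
have /eqP UE : U == (U + V)%VS by rewrite eqEdim addvSl (eqP dim1) dim_point.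
have /eqP VE : V == (U + V)%VS by rewrite eqEdim addvSr (eqP dim1) dim_point.
by rewrite UE -VE.
Qed.

Lemma multE (i : 'I_5) : mult v (v i) = count (same_point T i) indices.
Proof.
rewrite -card_ord_set /mult; apply: eq_card => j.
by rewrite !inE same_pointE eq_sym.
Qed.

Lemma multiplicitiesE : multiplicities v = table_mults T indices.
Proof.
rewrite /multiplicities codomE -[indices](val_enum_ord 5).
elim: (enum 'I_5) => //= i s IHs; rewrite -IHs has_map.
have -> : has (preim val (same_point T i)) s = (v i \in [seq v j | j <- s]).
  apply/hasP/mapP => -[j js]; first by rewrite /= same_pointE => /eqP; exists j.
  by move=> ij; exists j => //=; rewrite same_pointE ij.
by case: ifP => //= _; rewrite multE.
Qed.

Lemma with_multE ms : with_mult v ms = with_mult_table T ms.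
Proof. by rewrite /with_mult multiplicitiesE. Qed.

Lemma collinear_tripleE m :
  (set_of_mask m \in collinear_triples v) = collinear_triple_table T m.
Proof.
rewrite inE card_set_of_mask /collinear -get_rank_matrix.
rewrite /collinear_triple_table; case: (_ == 3); case: (get T m <= 2) => //=.
  rewrite andbT.
  pose inj_at (i j : nat) :=
    [&& nth false m i, nth false m j & same_point T i j] ==> (i == j).
  apply/dinjectiveP/(all_ordP (fun i => all (inj_at i) indices)) => [inj_v i | inj_v i j].
    apply/all_ordP => j; apply/implyP => /and3P[im jm].
    by rewrite same_pointE => /eqP/inj_v ->; rewrite ?inE.
  rewrite !inE => im jm /eqP ij; apply/val_inj/eqP.
  have /all_ordP/(_ j) := inj_v i; rewrite /inj_at same_pointE ij.
  by rewrite [nth _ _ i]im [nth _ _ j]jm.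
by rewrite andbF.
Qed.

Lemma card_collinear_triples :
  #|collinear_triples v| = count (collinear_triple_table T) masks.
Proof.
rewrite -(eq_count collinear_tripleE) -card_set_set.
by apply: eq_card => I; rewrite [in RHS]inE.
Qed.

Lemma collinear_triples_eq0 :
  (collinear_triples v == set0) = ~~ has (collinear_triple_table T) masks.
Proof. by rewrite -cards_eq0 card_collinear_triples -leqn0 leqNgt -has_count. Qed.

Lemma has_collinear_triple :
  (exists I, I \in collinear_triples v) <-> has (collinear_triple_table T) masks.
Proof.
rewrite -[has _ _]negbK -collinear_triples_eq0.
by split=> [/set0Pn | /set0Pn].
Qed.

(** Triples with one common point are distinct, so the left-hand side says that
    there are exactly two collinear triples and that they meet in one point. *)
Lemma two_collinear_triples :
  let lines := [seq m <- masks | collinear_triple_table T m] in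
  (exists I J, collinear_triples v = [set I; J] /\ #|I :&: J| = 1) <->
  (size lines == 2) && all (fun m => all (fun m' =>
    (m == m') || (count (fun i => nth false m i && nth false m' i) indices == 1))
    lines) lines.
Proof.
move=> lines.
have mem_lines m : (m \in lines) = (m \in masks) && (set_of_mask m \in collinear_triples v).
  by rewrite mem_filter collinear_tripleE andbC.
have card_meet m m' : count (fun i => nth false m i && nth false m' i) indices =
    #|set_of_mask m :&: set_of_mask m'|.
  by rewrite -card_ord_set; apply: eq_card => i; rewrite !inE.
rewrite size_filter -card_collinear_triples; split=> [[I [J [ctE IJ]]] | ].
  have I_neq_J : I != J.
    apply: contraTneq isT => eq_IJ; move: IJ; rewrite -eq_IJ setIid => I1.
    have : I \in collinear_triples v by rewrite ctE set21.
    by rewrite inE I1.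
  apply/andP; split; first by rewrite ctE cards2 I_neq_J.
  apply/allP => m m_l; apply/allP => m' m'_l.
  move: m_l m'_l; rewrite !mem_lines ctE card_meet => /andP[m_in m_IJ] /andP[m'_in m'_IJ].
  have [-> // | neq_mm'] := altP (m =P m').
  have : set_of_mask m != set_of_mask m'.
    apply: contraNneq neq_mm' => eq_mm'.
    by rewrite -(set_of_maskK m_in) eq_mm' set_of_maskK.
  by case/set2P: m_IJ => ->; case/set2P: m'_IJ => ->; rewrite ?eqxx // ?IJ // setIC IJ.
case/andP=> /cards2P[I [J [I_neq_J ctE]]] /allP pairwise.
have mask_lines L : L \in [set I; J] -> mask_of_set L \in lines.
  by rewrite -ctE mem_lines mask_of_set_masks mask_of_setK.
exists I, J; split=> //.
have /allP/(_ _ (mask_lines J (set22 I J))) := pairwise _ (mask_lines I (set21 I J)).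
by rewrite card_meet !mask_of_setK (can_eq mask_of_setK) (negPf I_neq_J) => /eqP.
Qed.

Lemma one_off_lineP n : n != 0 -> one_off_line v n <-> one_off_line_table T n.
Proof.
move=> n_neq0.
have offE (i : 'I_5) :
    let m := [seq ~~ same_point T i j | j <- indices] in
    let J := [set j | v j != v i] in
    [&& count (same_point T i) indices == n, get T m <= 2
      & get T m < get T full_mask] =
    [&& mult v (v i) == n, collinear v J & ~~ (val (v i) <= Span v J)%VS].
  move=> m J; rewrite -multE get_full_mask.
  have JE : set_of_mask m = J.
    apply/setP => j; rewrite !inE (nth_map 0) ?size_iota // nth_iota // add0n.
    by rewrite same_pointE eq_sym.
  rewrite get_rank_matrix JE; congr [&& _, _ & _].
  have -> : Span v setT = (val (v i) + Span v J)%VS.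
    apply/eqP; rewrite eqEsubv subv_add (Span_sub v (subsetT _)) andbT.
    apply/andP; split; last by apply: (sumv_sup i); rewrite ?inE.
    apply/subv_sumP => j _; have [-> | vj] := eqVneq (v j) (v i).
      exact: addvSl.
    by apply: subv_trans (addvSr _ _); apply: (sumv_sup j); rewrite ?inE.
  by rewrite (ltn_leqif (dimv_leqif_sup (addvSr _ _))) subv_add subvv andbT.
split=> [[p [mult_p col_p off_p]] | /has_ordP[i off_i]]; last first.
  by have /and3P[/eqP ? ? ?] := etrans (esym (offE i)) off_i; exists (v i).
have /card_gt0P[i] : 0 < mult v p by rewrite mult_p lt0n.
rewrite inE => /eqP vi; apply/has_ordP; exists i.
by apply: etrans (offE i) _; rewrite vi mult_p eqxx col_p off_p.
Qed.

Lemma has_plane_without_triple :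
  (exists J : {set 'I_5}, [/\ #|J| = 4, coplanar v J &
     forall I, I \in collinear_triples v -> ~~ (I \subset J)]) <->
  has (fun m => if (weight m == 4) && (get T m <= 3)
    then all (fun m' => collinear_triple_table T m' ==> ~~ submask m' m) masks
    else false) masks.
Proof.
pose good (J : {set 'I_5}) := if (#|J| == 4) && coplanar v J
  then all (fun m => (set_of_mask m \in collinear_triples v) ==>
                     ~~ (set_of_mask m \subset J)) masks else false.
rewrite (@eq_has _ _ (fun m => good (set_of_mask m))); last first.
  move=> m; rewrite /good card_set_of_mask /coplanar -get_rank_matrix.
  case: (_ && _) => //; apply: eq_all => m'.
  by rewrite collinear_tripleE subset_mask.
pose off (J I : {set 'I_5}) := (I \in collinear_triples v) ==> ~~ (I \subset J).
split=> [[J [J4 copl_J off_J]] | /has_setP[J]].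
  apply/has_setP; exists J; rewrite /good J4 copl_J.
  by apply/(all_setP (off J)) => I; apply/implyP/off_J.
rewrite /good; case: andP => // -[/eqP J4 copl_J] /(all_setP (off J)) off_J.
by exists J; split=> // I; apply/implyP/off_J.
Qed.

Lemma no_plane_of_four :
  (forall J : {set 'I_5}, #|J| = 4 -> ~~ coplanar v J) <->
  all (fun m => (weight m == 4) ==> ~~ (get T m <= 3)) masks.
Proof.
pose bad (J : {set 'I_5}) := (#|J| == 4) ==> ~~ coplanar v J.
rewrite (@eq_all _ _ (fun m => bad (set_of_mask m))); last first.
  by move=> m; rewrite /bad card_set_of_mask /coplanar -get_rank_matrix.
split=> [noncopl | /all_setP noncopl J J4]; last first.
  by have := noncopl J; rewrite /bad J4.
by apply/all_setP => J; apply/implyP => /eqP; apply: noncopl.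
Qed.

Lemma described_byP t : described_by t v <-> described_table t T.
Proof.
have andE (P Q : Prop) (b c : bool) : (P <-> b) -> (Q <-> c) -> (P /\ Q <-> b && c).
  by move=> [Pb bP] [Qc cQ]; split=> [[/Pb-> /Qc->] | /andP[/bP ? /cQ]].
have and3E (P Q R : Prop) (b c d : bool) : (P <-> b) -> (Q <-> c) -> (R <-> d) ->
    ([/\ P, Q & R] <-> if b && c then d else false).
  move=> [Pb bP] [Qc cQ] [Rd dR]; split=> [[/Pb-> /Qc-> /Rd->] // | ].
  by move=> /andP[/andP[/bP ? /cQ ?] /dR].
have eq0E : collinear_triples v = set0 <-> ~~ has (collinear_triple_table T) masks.
  by rewrite -collinear_triples_eq0; split=> /eqP.
case: t; rewrite /described_by /described_table /collinear /spans ?with_multE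
  -?get_full_mask; try (by []); try (apply: andE => //); try (apply: and3E => //).
- exact: one_off_lineP.
- exact: one_off_lineP.
- exact: one_off_lineP.
- exact: two_collinear_triples.
- by rewrite card_collinear_triples; split=> /eqP.
- exact: has_collinear_triple.
- exact: has_plane_without_triple.
- exact: no_plane_of_four.
Qed.

End Description.

(** * The classification *)

(** Every table of the classification satisfies the description of its own entry
    and no other description.  Hence descriptions characterize the types, and
    no map has two types. *)
Lemma described_entry_tables :
  all (fun t => all (fun T => all (fun t' => described_table t' T == (t' == t))
    entries) (entry_tables t)) entries.
Proof. by vm_compute. Qed.

Lemma described_tableE t t' T :
  T \in entry_tables t -> described_table t' T = (t' == t).
Proof.
have /allP t_desc := allP described_entry_tables t (mem_entries t).
by move/t_desc/allP/(_ t' (mem_entries t'))/eqP.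
Qed.

Lemma has_type_inj t t' phi : has_type t phi -> has_type t' phi -> t = t'.
Proof.
move=> /has_typeP T_t /has_typeP T_t'; apply/eqP.
by rewrite -(described_tableE t T_t') (described_tableE t T_t).
Qed.

Lemma has_type_described (K : fieldType) t (v : {ffun 'I_5 -> P3 K}) :
  has_type t (rank_matrix v) <-> described_by t v.
Proof.
have [t0 v_t0] := rank_matrix_has_type v.
have /has_typeP/(described_tableE t) descE := v_t0.
split=> [v_t | /described_byP]; last by rewrite descE => /eqP->.
by apply/described_byP; rewrite descE (has_type_inj v_t v_t0).
Qed.

Theorem theorem1p1 (K : closedFieldType) (charK : [pchar K]%R =i pred0) :
  [/\ (* the image of the rank matrix map *)
      forall phi : Map5,
        (exists v : {ffun 'I_5 -> P3 K}, rank_matrix v = phi) <->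
        (exists t : entry, has_type t phi),
      (* the configuration which each entry depicts *)
      forall (t : entry) (v : {ffun 'I_5 -> P3 K}),
        has_type t (rank_matrix v) <-> described_by t v,
      (* the number of configurations of ordered five points *)
      forall t : entry, has_card (has_type t) (entry_count t) &
      (* different entries depict different configurations *)
      forall (t t' : entry) (phi : Map5),
        has_type t phi -> has_type t' phi -> t = t'].
Proof.
split.
- move=> phi; split=> [[v <-] | [t t_phi]]; first exact: rank_matrix_has_type.
  exact: has_type_realized t_phi.
- exact: has_type_described.
- exact: has_card_type.
- exact: has_type_inj.
Qed.
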